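(* Let $n\ge 3$. For $i\ge 2$ let $c_i$ be the number of connected plane geometric graphs on $i$ points in convex position, and for $j\ge 2$ let $a_{j} = \sum_{i=2}^{j} \binom{j-2}{i-2}c_{i}$. The $n\times n$ matrix $$R_{n} = \begin{pmatrix} 0 & a_{2} & a_{3} & a_{4} & a_{5} & \cdots & a_{n} \\ 1 & 0 & a_{2} & a_{3} & a_{4} & \cdots & a_{n-1} \\ 0 & 1 & 0 & a_{2} & a_{3} & \cdots & a_{n-2} \\ 0 & 0 & 1 & 0 & a_{2} & \cdots & a_{n-3} \\ 0 & 0 & 0 & 1 & 0 & \cdots & a_{n-4} \\ \vdots & \vdots & \vdots & \vdots & \vdots & \ddots & \vdots \\ 0 & 0 & 0 & 0 & 0 & \cdots & 0 \end{pmatrix}$$ (whose $(p,q)$ entry is $a_{q-p+1}$ if $q>p$, $0$ if $q=p$, $1$ if $q=p-1$, and $0$ if $q<p-1$) is a production matrix for plane geometric graphs of point sets in convex position; that is, $v^{i+1}=R_n v^i$ for all $i\ge 1$ with $i+2\le n$.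
   Context: A geometric graph on a finite point set $\mathcal S\subseteq\mathbb R^2$ has vertex set $\mathcal S$ and edges that are straight-line segments with endpoints in $\mathcal S$; it is plane if no two edges intersect except at common endpoints. Graphs with $i$ vertices are considered on points $p_1,\dots,p_i$ in convex position labelled in counter-clockwise order. Two vertices are visible (from each other) if the line segment connecting them does not intersect the interior of any edge of the graph. The isolation degree of the root vertex $p_i$ of a graph on $\{p_1,\dots,p_i\}$ is the number of isolated vertices (vertices with no incident edge) of the graph that are visible from an additional vertex $p_{i+1}$ inserted between $p_i$ and $p_1$ in convex position; it is between $0$ and $i$. For $1\le i\le n-1$, $v^i$ is the $n$-dimensional column vector whose $j$-th entry is the number of plane geometric graphs on $i$ points in convex position whose root vertex has isolation degree $j-1$ (so $v^1=(0,1,0,\dots,0)^\top$). A production matrix is a matrix satisfying $v^{i+1}=R_nv^i$. *)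

(* Defs.v *)
From HB Require Import structures.
From mathcomp Require Import all_boot all_order all_algebra.
From mathcomp Require Import boolp classical_sets set_interval reals convex.

Set Implicit Arguments.
Unset Strict Implicit.
Unset Printing Implicit Defensive.

Import Order.TTheory GRing.Theory Num.Theory.
Local Open Scope ring_scope.

Section Geometry.
Variable R : realType.
Local Notation point := 'rV[R]_2.

Definition segment (x y : point) : set point :=
  [set (1 - t) *: x + t *: y | t in `[0, 1]%classic]%classic.

Definition open_segment (x y : point) : set point :=
  [set (1 - t) *: x + t *: y | t in `]0, 1[%classic]%classic.

(* Twice the signed area of the triangle xyz. *)
Definition orient (x y z : point) : R :=
  (y 0 0 - x 0 0) * (z 0 1 - x 0 1) - (y 0 1 - x 0 1) * (z 0 0 - x 0 0).

(* The hull is that of an indexed family, so the points are distinct too. *)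
Definition convex_position k (p : 'I_k -> point) : Prop :=
  forall i, ~ smallest (@convex_set R point)
                [set p j | j in [set j | j != i]]%classic (p i).

Definition counterclockwise k (p : 'I_k -> point) : Prop :=
  forall a b c : 'I_k, (a < b)%N -> (b < c)%N -> 0 < orient (p a) (p b) (p c).

Definition ccw_convex k (p : 'I_k -> point) : Prop :=
  convex_position p /\ counterclockwise p.

(* A graph on the labels 'I_k is its set of edges, an edge being a pair
   {a, b} with a != b; with p it becomes a geometric graph, where {a, b} is
   drawn as the segment from p a to p b. *)
Definition simple_graph k (E : {set {set 'I_k}}) : bool :=
  [forall e in E, #|e| == 2].

Definition noncrossing k (p : 'I_k -> point) (E : {set {set 'I_k}}) : Prop :=
  forall a b c d : 'I_k, [set a; b] \in E -> [set c; d] \in E ->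
    [set a; b] != [set c; d] ->
    forall x, segment (p a) (p b) x -> segment (p c) (p d) x ->
      exists2 w, w \in [set a; b] :&: [set c; d] & x = p w.

Definition plane_graphs k (p : 'I_k -> point) : {set {set {set 'I_k}}} :=
  [set E | simple_graph E && `[< noncrossing p E >]].

Definition adjacent k (E : {set {set 'I_k}}) : rel 'I_k :=
  [rel a b | [set a; b] \in E].

Definition connected_graph k (E : {set {set 'I_k}}) : bool :=
  [forall a, forall b, connect (adjacent E) a b].

Definition num_connected k (p : 'I_k -> point) : nat :=
  #|[set E in plane_graphs p | connected_graph E]|.

Definition isolated_vertex k (E : {set {set 'I_k}}) (u : 'I_k) : bool :=
  [forall e in E, u \notin e].

Definition visible k (p : 'I_k -> point) (E : {set {set 'I_k}}) (x y : point) :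
    Prop :=
  forall a b : 'I_k, [set a; b] \in E ->
    (segment x y `&` open_segment (p a) (p b) = set0)%classic.

(* A configuration of i + 1 points: the vertices of the graphs are the first i
   of them, and the last one is the point added after the root vertex. *)
Definition vertices i (p : 'I_i.+1 -> point) : 'I_i -> point :=
  fun u => p (widen_ord (leqnSn i) u).

Definition isolation_degree i (p : 'I_i.+1 -> point) (E : {set {set 'I_i}}) :
    nat :=
  #|[set u : 'I_i | isolated_vertex E u &&
       `[< visible (vertices p) E (vertices p u) (p ord_max) >]]|.

Definition isolation_vector n i (p : 'I_i.+1 -> point) : 'cV[nat]_n :=
  \col_(j < n) #|[set E in plane_graphs (vertices p) |
                    isolation_degree p E == j]|.

End Geometry.

Definition binomial_sum (c : nat -> nat) (j : nat) : nat :=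
  (\sum_(2 <= i < j.+1) 'C(j - 2, i - 2) * c i)%N.

Definition production_matrix (a : nat -> nat) (n : nat) : 'M[nat]_n :=
  \matrix_(p < n, q < n)
    if (p < q)%N then a (q - p + 1)%N else if (q + 1 == p)%N then 1%N else 0%N.

(* Main.v *)
(* In convex position, whether two edges cross and whether an edge hides a
   vertex from the added point depend only on the cyclic order of the labels:
   an isolated vertex u is visible exactly when no edge {a, b} has a < u < b.
   In a plane graph on i + 1 points, let C be the component of the root.
   Deleting the edges inside C leaves a plane graph on the first i points, in
   which every vertex of C other than the root is isolated and visible.
   Conversely any nonempty set of isolated visible vertices can be joined to
   the new root by any connected plane graph on their union; this hides
   precisely the isolated vertices from the least one of C on. If the degree
   drops from q to p < q, the least vertex of C is forced, and the remaining
   |C| - 2 are chosen freely among q - p - 1: there are a_(q-p+1) ways. *)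

Require Import Defs.
From HB Require Import structures.
From mathcomp Require Import all_boot all_order all_algebra.
From mathcomp Require Import boolp classical_sets set_interval reals convex.
(* Reimported last so that shared lemma names refer to finite sets rather than
   to classical ones. *)
From mathcomp Require Import fintype finset.
From mathcomp Require Import ring lra zify.

Set Implicit Arguments.
Unset Strict Implicit.
Unset Printing Implicit Defensive.

Import Order.TTheory GRing.Theory Num.Theory.
Local Open Scope ring_scope.

(** * Plane graphs described by the order of the labels *)

Section Planar.
Variable k : nat.
Implicit Types (e f : {set 'I_k}) (E : {set {set 'I_k}}).

(** Only the alternation that starts in [e] is tested; [planar] ranges over ordered pairs of edges
    and so covers the other one. *)
Definition crossing e f : bool :=
  [exists a in e, exists b in f, exists c in e, exists d in f,
    [&& a < b, b < c & c < d]%N].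

Definition planar E : bool :=
  simple_graph E && [forall e in E, forall f in E, ~~ crossing e f].

(** The weak inequalities let an edge span its own endpoints, so [uncovered] asks at once that a
    vertex be isolated and that no edge hide it from the added point. *)
Definition spans e (u : 'I_k) : bool :=
  [exists a in e, exists b in e, (a <= u <= b)%N].

Definition uncovered E : {set 'I_k} :=
  [set u | [forall e in E, ~~ spans e u]].

Lemma crossingP e f :
  reflect (exists a b c d : 'I_k, [/\ a \in e, b \in f, c \in e & d \in f] /\
             [/\ a < b, b < c & c < d]%N) (crossing e f).
Proof.
apply: (iffP exists_inP) => [[a ae /exists_inP[b bf /exists_inP[c ce /exists_inP
    [d df /and3P[ab bc cd]]]]]|[a [b [c [d [[ae bf ce df] [ab bc cd]]]]]]].
  by exists a, b, c, d.
exists a => //; apply/exists_inP; exists b => //; apply/exists_inP.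
by exists c => //; apply/exists_inP; exists d => //; apply/and3P.
Qed.

Lemma spansP e (u : 'I_k) :
  reflect (exists a b : 'I_k, [/\ a \in e, b \in e, (a <= u)%N & (u <= b)%N])
          (spans e u).
Proof.
apply: (iffP exists_inP) => [[a ae /exists_inP[b be /andP[au ub]]]|].
  by exists a, b.
move=> [a [b [ae be au ub]]]; exists a => //; apply/exists_inP.
by exists b => //; rewrite au ub.
Qed.

Lemma planarP E :
  reflect (simple_graph E /\ {in E &, forall e f, ~~ crossing e f}) (planar E).
Proof.
apply: (iffP andP) => [[sE /forall_inP nE]|[sE nE]]; split => //.
  by move=> e f eE fE; apply: (forall_inP (nE e eE)).
by apply/forall_inP => e eE; apply/forall_inP => f fE; apply: nE.
Qed.

Lemma uncoveredP E (u : 'I_k) :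
  reflect (forall e, e \in E -> ~~ spans e u) (u \in uncovered E).
Proof. by rewrite inE; apply: forall_inP. Qed.

Lemma simple_edge E e : simple_graph E -> e \in E ->
  exists a b : 'I_k, (a < b)%N /\ e = [set a; b].
Proof.
move=> /forall_inP sE eE; have /cards2P[a [b [ab ->]]] := sE e eE.
case: (ltngtP a b) => [lt|lt|/val_inj eq]; first by exists a, b.
- by exists b, a; rewrite setUC.
- by rewrite eq eqxx in ab.
Qed.

Lemma simple_edgeE E e (a b : 'I_k) :
  simple_graph E -> e \in E -> a \in e -> b \in e -> (a < b)%N ->
  e = [set a; b].
Proof.
move=> /forall_inP sE eE ae be ab; apply/eqP; rewrite eq_sym eqEcard.
rewrite subUset !sub1set ae be (eqP (sE e eE)) cards2 /=.
by rewrite -val_eqE /= neq_ltn ab.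
Qed.

Lemma simple_edge_neq E (a b : 'I_k) :
  simple_graph E -> [set a; b] \in E -> a != b.
Proof. by move=> /forall_inP sE /sE; rewrite cards2; case: (a != b). Qed.

End Planar.

(** * Orientations, intersections of segments, and the passage from geometry to labels *)

Section Geometry.
Variable R : realType.
Local Notation point := 'rV[R]_2.
Implicit Types A B C D x y : point.

Lemma row2P x y : x 0 0 = y 0 0 -> x 0 1 = y 0 1 -> x = y.
Proof.
move=> e0 e1; apply/rowP => i.
by have /orP[/eqP->|/eqP->] : (i == 0) || (i == 1) by case: i => [[|[|]]].
Qed.

Lemma segmentP A B x : segment A B x ->
  exists t, [/\ 0 <= t, t <= 1 & x = (1 - t) *: A + t *: B].
Proof. by move=> [t /=]; rewrite in_itv /= => /andP[t0 t1] <-; exists t. Qed.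

Lemma segmentC A B : segment A B = segment B A.
Proof.
apply/seteqP; split=> x /segmentP[t [t0 t1 ->]]; exists (1 - t) => /=;
  by [rewrite in_itv /=; lra | rewrite subKr addrC].
Qed.

Lemma open_segment_sub A B : (open_segment A B `<=` segment A B)%classic.
Proof.
move=> x [t /=]; rewrite in_itv /= => /andP[t0 t1] <-; exists t => //=.
by rewrite in_itv /=; lra.
Qed.

Lemma orient_combination A B C D t :
  orient A B ((1 - t) *: C + t *: D) =
  (1 - t) * orient A B C + t * orient A B D.
Proof. by rewrite /orient !mxE; ring. Qed.

Lemma orient_cycle A B C : orient A B C = orient B C A.
Proof. by rewrite /orient; ring. Qed.

Lemma orient_swap A B C : orient A B C = - orient B A C.
Proof. by rewrite /orient; ring. Qed.

Lemma orient_segment A B x : segment A B x -> orient A B x = 0.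
Proof.
by move=> /segmentP[t [_ _ ->]]; rewrite orient_combination /orient; ring.
Qed.

(** The diagonals of a convex quadrilateral divide each other in ratios of areas: the parameter is
    [ABD] over the total area along [AC], and [ABC] over the total along [BD]. The total is computed
    from either diagonal. *)
Lemma diagonals_meet A B C D :
  0 < orient A B C -> 0 < orient A B D ->
  0 < orient A C D -> 0 < orient B C D ->
  exists2 x, open_segment A C x & open_segment B D x.
Proof.
move=> ABC ABD ACD BCD.
have area : orient A B D + orient B C D = orient A B C + orient A C D.
  by rewrite /orient; ring.
have pos1 : 0 < orient A B D + orient B C D by lra.
have unit_frac (u v : R) : 0 < u -> 0 < v -> 0 < u / (u + v) < 1.
  move=> u0 v0; have uv : 0 < u + v by lra.
  by apply/andP; split; [exact: divr_gt0 | rewrite ltr_pdivrMr //; lra].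
exists ((1 - orient A B D / (orient A B D + orient B C D)) *: A +
        (orient A B D / (orient A B D + orient B C D)) *: C).
  by exists (orient A B D / (orient A B D + orient B C D)) => //=;
     rewrite in_itv /= unit_frac.
exists (orient A B C / (orient A B D + orient B C D)) => /=.
  by rewrite in_itv /= area unit_frac.
have : orient A B D + orient B C D != 0 by rewrite gt_eqF.
by move=> nz; apply: row2P; rewrite !mxE; move: nz; rewrite /orient => nz;
   field.
Qed.

(** The orientation relative to the line [AB] is affine along [CD] and has the same strict sign at
    both ends, so it has no zero there, whereas it vanishes on [AB]. *)
Lemma same_side_disjoint A B C D x :
  0 < orient A B C * orient A B D -> segment A B x -> segment C D x -> False.
Proof.
move=> CD /orient_segment gx /segmentP[t [t0 t1 ex]].
move: gx; rewrite ex orient_combination; move: CD.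
move: (orient A B C) (orient A B D) => u v uv eq0.
have u2 : 0 < u ^+ 2.
  by rewrite exprn_even_gt0 //=; apply: contraTneq uv => ->; rewrite mul0r ltxx.
(* Multiplying by [u] makes both terms nonnegative whatever the sign of [u]. *)
have : (1 - t) * u ^+ 2 + t * (u * v) = 0 by rewrite -[RHS](mulr0 u) -eq0; ring.
case: (ltrP 0 t) => [tp|tn].
  have : 0 < t * (u * v) by exact: mulr_gt0.
  have : 0 <= (1 - t) * u ^+ 2 by rewrite mulr_ge0 ?subr_ge0 // ltW.
  by lra.
have -> : t = 0 by lra.
by rewrite subr0 mul1r mul0r addr0 => eq; rewrite eq ltxx in u2.
Qed.

(** Along [AC] the orientation relative to [AB] is [t * orient A B C], which vanishes only at
    [t = 0]. *)
Lemma segments_from_vertex A B C x :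
  orient A B C != 0 -> segment A B x -> segment A C x -> x = A.
Proof.
move=> ABC /orient_segment gx /segmentP[t [t0 t1 ex]].
move: gx; rewrite ex orient_combination.
have -> : orient A B A = 0 by rewrite /orient; ring.
rewrite mulr0 add0r => /eqP; rewrite mulf_eq0 (negPf ABC) orbF => /eqP ->.
by rewrite subr0 scale1r scale0r addr0.
Qed.

Section Configuration.
Variables (k : nat) (p : 'I_k -> point) (hp : counterclockwise p).

(** For [a < b], the line through [p a] and [p b] separates the labels strictly between [a] and [b],
    on its right, from all others, on its left. *)
Lemma ccw_inside (a b c : 'I_k) :
  (a < c)%N -> (c < b)%N -> orient (p a) (p b) (p c) < 0.
Proof.
by move=> ac cb; rewrite orient_swap orient_cycle oppr_lt0 hp.
Qed.

Lemma ccw_outside (a b c : 'I_k) :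
  (a < b)%N -> (c < a)%N || (b < c)%N -> 0 < orient (p a) (p b) (p c).
Proof.
by move=> ab /orP[ca|bc]; [rewrite -orient_cycle|]; apply: hp.
Qed.

Lemma ccw_neq0 (a b c : 'I_k) :
  a != b -> a != c -> b != c -> orient (p a) (p b) (p c) != 0.
Proof.
wlog ab : a b / (a < b)%N => [hw|] nab nac nbc.
  case: (ltngtP a b) => [lt|lt|/val_inj eq]; first exact: hw.
    by rewrite orient_swap oppr_eq0; apply: hw; rewrite // eq_sym.
  by rewrite eq eqxx in nab.
case: (ltngtP a c) => [ac|ca|/val_inj eq]; last by rewrite eq eqxx in nac.
  case: (ltngtP b c) => [bc|cb|/val_inj eq]; last by rewrite eq eqxx in nbc.
    by rewrite gt_eqF // ccw_outside // bc orbT.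
  by rewrite lt_eqF // ccw_inside.
by rewrite gt_eqF // ccw_outside // ca.
Qed.

Lemma interleaved_meet (a b c d : 'I_k) : (a < b)%N -> (b < c)%N -> (c < d)%N ->
  exists2 x, open_segment (p a) (p c) x & open_segment (p b) (p d) x.
Proof.
by move=> ab bc cd; apply: diagonals_meet; apply: hp => //;
  do ?[exact: ltn_trans bc _ | exact: ltn_trans ab _ |
       apply: ltn_trans ab _; exact: ltn_trans bc _ ].
Qed.

Lemma outside_disjoint (a b c d : 'I_k) x : (a < b)%N ->
  (c < a)%N || (b < c)%N -> (d < a)%N || (b < d)%N ->
  segment (p a) (p b) x -> segment (p c) (p d) x -> False.
Proof.
by move=> ab cab dab; apply: same_side_disjoint;
  rewrite mulr_gt0 ?ccw_outside.
Qed.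

Lemma inside_disjoint (a b c d : 'I_k) x :
  (a < c)%N -> (c < b)%N -> (a < d)%N -> (d < b)%N ->
  segment (p a) (p b) x -> segment (p c) (p d) x -> False.
Proof.
by move=> ac cb ad db; apply: same_side_disjoint;
  rewrite nmulr_rgt0 ?ccw_inside.
Qed.

(** Alternating edges are diagonals of a convex quadrilateral and meet away from common endpoints.
    Edges that do not alternate either share an endpoint, and meet only there, or one of them lies
    strictly on one side of the other. *)
Lemma noncrossingP E : simple_graph E ->
  noncrossing p E <-> {in E &, forall e f, ~~ crossing e f}.
Proof.
move=> sE; split=> [nE e f eE fE|nE a b c d abE cdE nabcd x].
  apply/negP => /crossingP[a [b [c [d [[ae bf ce df] [ab bc cd]]]]]].
  have eac : e = [set a; c].
    by apply: (simple_edgeE sE); rewrite // (ltn_trans ab).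
  have fbd : f = [set b; d].
    by apply: (simple_edgeE sE); rewrite // (ltn_trans bc).
  have [x xac xbd] := interleaved_meet ab bc cd.
  rewrite eac in eE; rewrite fbd in fE.
  have disj w : w \in [set a; c] -> w \in [set b; d] -> False.
    rewrite !inE => /orP[]/eqP-> /orP[]/eqP; move=> /(congr1 val) /=; lia.
  have neq : [set a; c] != [set b; d].
    by apply/eqP => eq; apply: (disj a); rewrite -?eq set21.
  have [w] :=
    nE a c b d eE fE neq x (open_segment_sub xac) (open_segment_sub xbd).
  by rewrite inE => /andP[/disj].
have nab := simple_edge_neq sE abE; have ncd := simple_edge_neq sE cdE.
wlog ab : a b abE nabcd nab / (a < b)%N => [hw|].
  case: (ltngtP a b) => [lt|lt|/val_inj eq]; first exact: hw.
    by rewrite (segmentC (p a)) (setUC [set a]); apply: hw;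
       rewrite // 1?(setUC [set b]) // eq_sym.
  by rewrite eq eqxx in nab.
wlog cd : c d cdE nabcd ncd / (c < d)%N => [hw|].
  case: (ltngtP c d) => [lt|lt|/val_inj eq]; first exact: hw.
    rewrite (segmentC (p c)) (setUC [set c]).
    by apply: hw; rewrite // 1?(setUC [set d]) // eq_sym.
  by rewrite eq eqxx in ncd.
move=> xab xcd.
have nc e f (a' b' c' d' : 'I_k) : e \in E -> f \in E -> a' \in e -> b' \in f ->
    c' \in e -> d' \in f -> (a' < b')%N -> (b' < c')%N -> (c' < d')%N -> False.
  move=> eE fE ? ? ? ? ? ? ?; apply: (negP (nE e f eE fE)); apply/crossingP.
  by exists a', b', c', d'.
(* Distinct edges with a common endpoint are not collinear; the four possible coincidences are
   treated in turn. *)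
case: (eqVneq a c) => [eq|nac].
  subst c; exists a; first by rewrite !inE eqxx.
  apply: (segments_from_vertex _ xab xcd); apply: ccw_neq0 => //.
  by apply: contraNneq nabcd => ->.
case: (eqVneq a d) => [eq|nad].
  subst d; exists a; first by rewrite !inE eqxx orbT.
  rewrite segmentC in xcd.
  apply: (segments_from_vertex _ xab xcd); apply: ccw_neq0 => //.
  by apply: contraNneq nabcd => ->; rewrite setUC.
case: (eqVneq b c) => [eq|nbc].
  subst c; exists b; first by rewrite !inE eqxx orbT.
  rewrite segmentC in xab.
  by apply: (segments_from_vertex _ xab xcd); apply: ccw_neq0;
    rewrite // eq_sym.
case: (eqVneq b d) => [eq|nbd].
  subst d; exists b; first by rewrite !inE eqxx !orbT.
  rewrite segmentC in xab; rewrite segmentC in xcd.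
  by apply: (segments_from_vertex _ xab xcd); apply: ccw_neq0;
    rewrite // eq_sym.
have {}nac : (a != c :> nat)%N by []. have {}nad : (a != d :> nat)%N by [].
have {}nbc : (b != c :> nat)%N by []. have {}nbd : (b != d :> nat)%N by [].
exfalso.
(* With four distinct labels, exactly one of [c], [d] between [a] and [b] would be an alternation;
   otherwise both lie on the same side of the line. *)
case: (boolP ((a < c)%N && (c < b)%N)) => [/andP[ac cb]|cout].
  case: (ltnP d b) => [db|bd].
    by apply: (inside_disjoint _ _ _ _ xab xcd); lia.
  by apply: (nc _ _ a c b d abE cdE); rewrite ?set21 ?set22 //; lia.
case: (boolP ((a < d)%N && (d < b)%N)) => [/andP[ad db]|dout].
  by apply: (nc _ _ c a d b cdE abE); rewrite ?set21 ?set22 //; lia.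
by apply: (outside_disjoint _ _ _ xab xcd); lia.
Qed.

Lemma plane_graphsE : plane_graphs p = [set E | planar E].
Proof.
apply/setP => E; rewrite !inE; apply/andP/planarP => [[sE /asboolP nE]|[sE nE]].
  by split=> //; apply/noncrossingP.
by split=> //; apply/asboolP/noncrossingP.
Qed.

End Configuration.

Lemma counterclockwise_vertices i (p : 'I_i.+1 -> point) :
  counterclockwise p -> counterclockwise (vertices p).
Proof. by move=> hp a b c ab bc; apply: hp. Qed.

(** The added point has the largest label, so an edge from [a] to [b] meets the line of sight of an
    isolated [u] exactly when [a < u < b], the four labels then alternating. *)
Lemma isolation_degreeE i (p : 'I_i.+1 -> point) (E : {set {set 'I_i}}) :
  counterclockwise p -> simple_graph E ->
  isolation_degree p E = #|uncovered E|.
Proof.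
move=> hp sE; apply: eq_card => u; rewrite inE.
apply/andP/uncoveredP => [[iu /asboolP vis] e eE|unc].
  have [a [b [ab ee]]] := simple_edge sE eE; subst e.
  have := forall_inP iu _ eE; rewrite !inE negb_or => /andP[ua ub].
  apply/spansP => -[a' [b' [a'e b'e a'u ub']]].
  have [au {}ub] : (a < u)%N /\ (u < b)%N.
    have {}ua : (u != a :> nat)%N by [].
    have {}ub : (u != b :> nat)%N by [].
    by move: a'e b'e; rewrite !inE => /orP[]/eqP? /orP[]/eqP?; subst; lia.
  have [||| x xab xum] := interleaved_meet hp
    (a := widen_ord (leqnSn i) a) (b := widen_ord (leqnSn i) u)
    (c := widen_ord (leqnSn i) b) (d := ord_max) => //=.
  have := vis a b eE; rewrite -classical_sets.subset0 => /(_ x).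
  apply; split=> //.
  exact: open_segment_sub.
have niso (a b : 'I_i) : [set a; b] \in E -> (a < b)%N ->
    (u < a)%N || (b < u)%N.
  move=> abE ab; have := unc _ abE; apply: contraR => out.
  by apply/spansP; exists a, b; rewrite set21 set22; split=> //; lia.
split.
  apply/forall_inP => e eE; have [a [b [ab ee]]] := simple_edge sE eE; subst e.
  have := niso a b eE ab; rewrite !inE negb_or => out.
  by apply/andP; split; apply: contraTneq out => ->; lia.
apply/asboolP => a b abE; rewrite -classical_sets.subset0 => x [xu xab].
wlog ab : a b abE xab / (a < b)%N => [hw|].
  have := simple_edge_neq sE abE.
  case: (ltngtP a b) => [lt|lt|/val_inj eq] nab; first exact: (hw a b).
    apply: (hw b a) => //; first by rewrite setUC.
    move: xab => [t /=]; rewrite in_itv /= => /andP[t0 t1] <-.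
    by exists (1 - t) => /=; [rewrite in_itv /=; lra | rewrite subKr addrC].
  by rewrite eq eqxx in nab.
(* Both [u] and the added point have labels outside the range from [a] to [b], hence lie on the same
   side of the edge. *)
apply: (outside_disjoint hp (a := widen_ord (leqnSn i) a)
  (b := widen_ord (leqnSn i) b) (c := widen_ord (leqnSn i) u) (d := ord_max)
  _ _ _ (open_segment_sub xab) xu) => //=; first exact: niso.
by rewrite ltn_ord orbT.
Qed.

End Geometry.

(** * Reachability and order-preserving relabelling *)

Lemma connect_invariant (T : finType) (e : rel T) (D : {pred T}) x y :
  (forall u v, u \in D -> e u v -> v \in D) ->
  x \in D -> connect e x y -> y \in D.
Proof.
move=> De xD /connectP[s es ->]; elim: s x xD es => //= z s IH x xD /andP[xz].
by apply: IH; apply: De xz.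
Qed.

Lemma adjacent_connect_sym k (E : {set {set 'I_k}}) :
  connect_sym (adjacent E).
Proof. by apply: sym_connect_sym => a b; rewrite /adjacent /= setUC. Qed.

Section Relabelling.
Variables (k m : nat) (f : 'I_k -> 'I_m).
Hypothesis le_f : forall a b, (f a <= f b)%N = (a <= b)%N.
Implicit Types (E : {set {set 'I_k}}) (e : {set 'I_k}).

(** Used for two maps: the increasing enumeration of a set of labels, and the inclusion of the first
    [i] labels among [i + 1]. *)
Definition relabel E : {set {set 'I_m}} := [set f @: e | e : {set 'I_k} in E].

Let lt_f a b : (f a < f b)%N = (a < b)%N.
Proof. by rewrite !ltnNge le_f. Qed.

Let f_inj : injective f.
Proof.
by move=> a b fab; apply/val_inj/eqP; rewrite eqn_leq -!le_f fab leqnn.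
Qed.

Lemma relabel_inj : injective relabel.
Proof. exact/imset_inj/imset_inj. Qed.

Lemma mem_relabel E e : (f @: e \in relabel E) = (e \in E).
Proof. exact/mem_imset/imset_inj. Qed.

Lemma crossing_imset e e' : crossing (f @: e) (f @: e') = crossing e e'.
Proof.
apply/crossingP/crossingP => -[a [b [c [d [[ae be ce de] [ab bc cd]]]]]].
  move: ae be ce de ab bc cd => /imsetP[a' ae ->] /imsetP[b' be ->].
  move=> /imsetP[c' ce ->] /imsetP[d' de ->]; rewrite !lt_f => ab bc cd.
  by exists a', b', c', d'.
by exists (f a), (f b), (f c), (f d); rewrite !lt_f !(mem_imset _ _ f_inj).
Qed.

Lemma planar_relabel E : planar (relabel E) = planar E.
Proof.
apply/planarP/planarP => -[sE nE]; split.
- by apply/forall_inP => e eE; rewrite -(card_imset _ f_inj);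
    apply: (forall_inP sE); rewrite mem_relabel.
- by move=> e e' eE eE'; rewrite -crossing_imset; apply: nE;
    rewrite mem_relabel.
- by apply/forall_inP => _ /imsetP[e eE ->]; rewrite card_imset //;
    apply: (forall_inP sE).
- by move=> _ _ /imsetP[e eE ->] /imsetP[e' eE' ->]; rewrite crossing_imset nE.
Qed.

Lemma spans_imset e u : spans (f @: e) (f u) = spans e u.
Proof.
apply/spansP/spansP => -[a [b [ae be au ub]]].
  move: ae be au ub => /imsetP[a' ae ->] /imsetP[b' be ->].
  by rewrite !le_f => au ub; exists a', b'.
by exists (f a), (f b); rewrite !le_f !(mem_imset _ _ f_inj).
Qed.

Lemma uncovered_relabel E u :
  (f u \in uncovered (relabel E)) = (u \in uncovered E).
Proof.
apply/uncoveredP/uncoveredP => unc e.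
  by move=> eE; rewrite -spans_imset unc // mem_relabel.
by move=> /imsetP[e' eE ->]; rewrite spans_imset unc.
Qed.

Lemma adjacent_relabel E a b :
  adjacent (relabel E) (f a) (f b) = adjacent E a b.
Proof. by rewrite /adjacent /= -mem_relabel imsetU !imset_set1. Qed.

Lemma relabel_onto (E' : {set {set 'I_m}}) :
  (forall A, A \in E' -> A \subset f @: setT) -> exists E, E' = relabel E.
Proof.
move=> sub; exists [set e : {set 'I_k} | f @: e \in E']; apply/setP => A.
apply/idP/imsetP => [AE|[e' ]]; last by rewrite inE => ? ->.
suff fA : f @: (f @^-1: A) = A by exists (f @^-1: A); rewrite ?inE fA.
apply/setP => x; apply/imsetP/idP => [[y]|xA]; first by rewrite inE => ? ->.
have /imsetP[y _ xy] := subsetP (sub A AE) x xA.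
by exists y; rewrite // inE -xy.
Qed.

Lemma connect_relabel E a b :
  connect (adjacent (relabel E)) (f a) (f b) = connect (adjacent E) a b.
Proof.
(* Every edge of the relabelled graph lies in the image of [f], so a path that starts in the image
   stays there and can be pulled back. *)
apply/idP/idP => [cab|].
  suff : f b \in f @: [set x | connect (adjacent E) a x].
    by rewrite mem_imset // inE.
  apply: connect_invariant cab; last by rewrite mem_imset // inE.
  move=> _ v /imsetP[x + ->]; rewrite inE => ax xv.
  have /imsetP[y _ vy] : v \in f @: setT.
    have /imsetP[e _ ee] := xv.
    have : v \in f @: e by rewrite -ee set22.
    by move=> /imsetP[y _ ->]; apply: imset_f.
  rewrite vy mem_imset // inE; apply: connect_trans ax (connect1 _).
  by rewrite -adjacent_relabel -vy.
pose D := [pred x | connect (adjacent (relabel E)) (f a) (f x)].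
apply: (@connect_invariant _ _ D) => [x y ax xy|].
  by apply: connect_trans ax (connect1 _); rewrite adjacent_relabel.
by rewrite inE.
Qed.

End Relabelling.

(** * Connected plane graphs on a subset of the labels *)

Lemma leq_enum_val k (A : {set 'I_k}) (a b : 'I_#|A|) :
  ((Order.enum_val a : 'I_k) <= (Order.enum_val b : 'I_k))%N = (a <= b)%N.
Proof. exact: (Order.le_enum_val (@le_total _ 'I_k) a b). Qed.

Lemma imset_enum_val k (A : {set 'I_k}) :
  @Order.enum_val _ _ A @: setT = A.
Proof.
apply/eqP; rewrite eqEcard card_imset ?cardsT ?card_ord ?leqnn ?andbT.
  by apply/subsetP => _ /imsetP[a _ ->]; apply: Order.enum_valP.
exact: Order.enum_val_inj.
Qed.

Definition num_connected_planar (k : nat) : nat :=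
  #|[set E : {set {set 'I_k}} | planar E && connected_graph E]|.

(** The graph keeps the full label set, so that it can be united with other graphs; labels outside
    [A] are isolated. *)
Definition connected_on k (A : {set 'I_k}) (E : {set {set 'I_k}}) : bool :=
  [&& planar E, [forall e in E, e \subset A] &
      [forall a in A, forall b in A, connect (adjacent E) a b]].

Lemma connected_onP k (A : {set 'I_k}) (E : {set {set 'I_k}}) :
  reflect [/\ planar E, forall e, e \in E -> e \subset A &
              {in A &, forall a b, connect (adjacent E) a b}]
          (connected_on A E).
Proof.
apply: (iffP and3P) => [[pE /forall_inP sE /forall_inP cE]|[pE sE cE]].
  by split=> // a b aA bA; apply: (forall_inP (cE a aA)).
split=> //; first exact/forall_inP.
by apply/forall_inP => a aA; apply/forall_inP => b bA; apply: cE.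
Qed.

(** The increasing enumeration of [A] preserves crossings and reachability, so only the size of [A]
    matters. *)
Lemma card_connected_on k (A : {set 'I_k}) :
  #|[set E | connected_on A E]| = num_connected_planar #|A|.
Proof.
pose f : 'I_#|A| -> 'I_k := Order.enum_val.
have le_f : forall a b, (f a <= f b)%N = (a <= b)%N := @leq_enum_val k A.
have fA : f @: setT = A := imset_enum_val A.
rewrite /num_connected_planar -(card_imset _ (relabel_inj le_f)).
apply: eq_card => E; rewrite inE; apply/connected_onP/imsetP.
  move=> [pE sE cE]; have [|E0 EE0] := @relabel_onto _ _ f E.
    by rewrite fA.
  exists E0 => //; rewrite inE -(planar_relabel le_f) -EE0 pE /=.
  apply/forallP => a; apply/forallP => b.
  by rewrite -(connect_relabel le_f) -EE0 cE // -fA imset_f.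
move=> [E0 + ->]; rewrite inE => /andP[pE /forallP cE]; split.
- by rewrite planar_relabel.
- move=> _ /imsetP[e _ ->]; apply/subsetP => _ /imsetP[a _ ->].
  exact: Order.enum_valP.
- have onA x : x \in A -> exists a, x = f a.
    by rewrite -{1}fA => /imsetP[a _ ->]; exists a.
  by move=> _ _ /onA[a ->] /onA[b ->]; rewrite connect_relabel //;
    apply: (forallP (cE a)).
Qed.

(** * Decomposition of a plane graph at the component of its root *)

Section RootComponent.
Variable i : nat.
Local Notation root := (@ord_max i).
Implicit Types (E : {set {set 'I_i.+1}}) (C U : {set 'I_i.+1}).

Definition root_component E : {set 'I_i.+1} :=
  [set x | connect (adjacent E) root x].

Definition avoids_root E : bool := [forall e in E, root \notin e].

(** These are the plane graphs on the first [i] points to which a connected graph on [C] can be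
    attached. *)
Definition compatible C : {set {set {set 'I_i.+1}}} :=
  [set E | [&& planar E, avoids_root E & C \subset uncovered E]].

(** What is left of the uncovered set [U] after a connected graph on [C] is added. For [C] reduced
    to the root no edge is added; otherwise everything from the least vertex of [C] up to the root
    becomes spanned. *)
Definition remaining C U : {set 'I_i.+1} :=
  if C == [set root] then U else [set u in U | [forall c in C, u < c]%N].

Lemma root_component_split E : planar E ->
  let C := root_component E in
  let E1 := [set e in E | e \subset C] in
  connected_on C E1 /\ E :\: E1 \in compatible C.
Proof.
move=> /planarP[sE nE] C E1.
have rC : root \in C by rewrite inE.
have E1E e : e \in E1 -> e \in E by rewrite inE => /andP[].
have closedC x y : [set x; y] \in E -> x \in C -> y \in C.
  move=> xyE; rewrite !inE => rx; apply: connect_trans rx (connect1 _).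
  exact: xyE.
(* A path from the root never leaves [C], so all its edges already belong to [E1]. *)
have conn_r x : x \in C -> connect (adjacent E1) root x.
  rewrite inE => rx.
  have : x \in [set y in C | connect (adjacent E1) root y].
    apply: connect_invariant rx; last by rewrite inE rC /=.
    move=> u v; rewrite [in X in X -> _]inE => /andP[uC ru] uv.
    have vC := closedC u v uv uC.
    rewrite inE vC; apply: connect_trans ru (connect1 _).
    have uvE : [set u; v] \in E by exact: uv.
    by rewrite /adjacent /= inE uvE subUset !sub1set uC vC.
  by rewrite inE => /andP[].
split.
  apply/connected_onP; split.
  - apply/planarP; split.
      by apply/forall_inP => e /E1E; apply: (forall_inP sE).
    by move=> e f /E1E eE /E1E fE; apply: nE.
  - by move=> e; rewrite inE => /andP[].
  - move=> a b /conn_r ra /conn_r rb.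
    by apply: connect_trans rb; rewrite adjacent_connect_sym.
have E2E e : e \in E :\: E1 -> e \in E by rewrite inE => /andP[].
(* An edge with one endpoint in the component has both there, and so belongs to [E1]. *)
have disjC e x : e \in E :\: E1 -> x \in e -> x \notin C.
  rewrite !inE => /andP[+ eE] xe; rewrite eE /=; apply: contra => xC.
  have [a [b [ab ee]]] := simple_edge sE eE; subst e.
  have baE : [set b; a] \in E by rewrite setUC.
  have xC' : x \in C by rewrite inE.
  rewrite subUset !sub1set; move: xe xC'; rewrite !in_set2 => /orP[]/eqP-> zC.
    by rewrite zC (closedC a b eE zC).
  by rewrite zC (closedC b a baE zC).
rewrite inE; apply/and3P; split.
- apply/planarP; split.
    by apply/forall_inP => e /E2E; apply: (forall_inP sE).
  by move=> e f /E2E eE /E2E fE; apply: nE.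
- by apply/forall_inP => e eE; apply: contraL rC; apply: disjC.
apply/subsetP => c cC; apply/uncoveredP => e eE; apply/spansP.
move=> [a [b [ae be ac cb]]].
have aC := disjC e a eE ae; have bC := disjC e b eE be.
have neq (x y : 'I_i.+1) : x \in C -> y \notin C -> (x != y :> nat)%N.
  by move=> xC; apply: contraNneq => /val_inj <-.
have {}ac : (a < c)%N by have := neq c a cC aC; lia.
have {}cb : (c < b)%N by have := neq c b cC bC; lia.
(* An edge spanning a vertex of the component of the root would cut every
   path from that vertex to the root. *)
have : root \in [set x : 'I_i.+1 | (a < x < b)%N].
  apply: (connect_invariant (x := c) (e := adjacent E1)).
  - move=> x y; rewrite [in X in X -> _]inE => /andP[ax xb] xyE.
    have /andP[xC yC] : (x \in C) && (y \in C).
      by move: xyE; rewrite /adjacent /= inE subUset !sub1set => /andP[].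
    have ya := neq y a yC aC; have yb := neq y b yC bC.
    rewrite inE; case: (ltnP a y) => [ay|ya'] /=.
      case: (ltnP y b) => // by'.
      exfalso; apply: (negP (nE _ _ (E2E e eE) (E1E _ xyE))).
      apply/crossingP; exists a, x, b, y; rewrite set21 set22.
      by split=> //; split=> //; lia.
    exfalso; apply: (negP (nE _ _ (E1E _ xyE) (E2E e eE))).
    apply/crossingP; exists y, a, x, b; rewrite set21 set22.
    by split=> //; split=> //; lia.
  - by rewrite inE ac cb.
  - by rewrite adjacent_connect_sym; apply: conn_r.
by rewrite inE /= => /andP[_]; have := ltn_ord b; lia.
Qed.

Lemma edge_disjoint E C e x :
  E \in compatible C -> e \in E -> x \in e -> x \notin C.
Proof.
rewrite inE => /and3P[_ _ /subsetP CU] eE xe.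
apply/negP => /CU/uncoveredP/(_ e eE)/spansP; apply.
by exists x, x.
Qed.

Lemma edge_nonempty E e : planar E -> e \in E -> exists x, x \in e.
Proof.
move=> /planarP[sE _] eE; have [a [b [_ ->]]] := simple_edge sE eE.
by exists a; rewrite set21.
Qed.

(** * Gluing a connected graph on [C] to a compatible graph *)

Section Union.
Variables (C : {set 'I_i.+1}) (E1 E2 : {set {set 'I_i.+1}}).
Hypotheses (rC : root \in C) (E1C : connected_on C E1)
  (E2C : E2 \in compatible C).

Lemma union_left : [set e in E1 :|: E2 | e \subset C] = E1.
Proof.
have /connected_onP[_ sub1 _] := E1C.
apply/setP => e; rewrite !inE; apply/andP/idP => [[/orP[//|eE] /subsetP eC]|eE].
  have [x xe] : exists x, x \in e.
    by move: E2C; rewrite inE => /and3P[pE _ _]; apply: edge_nonempty eE.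
  by have := edge_disjoint E2C eE xe; rewrite eC.
by rewrite eE sub1.
Qed.

Lemma union_right : (E1 :|: E2) :\: E1 = E2.
Proof.
rewrite setDUl setDv set0U; apply/setDidPl; rewrite -setI_eq0.
apply/eqP/setP => e; rewrite in_set0; apply/negbTE/negP => /setIP[eE2 eE1].
have /connected_onP[pE sub1 _] := E1C.
have [x xe] := edge_nonempty pE eE1.
by have := edge_disjoint E2C eE2 xe; rewrite (subsetP (sub1 e eE1)).
Qed.

(** In a crossing of an edge of [E1] with one of [E2], an endpoint of the former, which is in [C],
    would be spanned by the latter. *)
Lemma planar_union : planar (E1 :|: E2).
Proof.
have /connected_onP[/planarP[s1 n1] sub1 _] := E1C.
have := E2C; rewrite inE => /and3P[/planarP[s2 n2] _ /subsetP CU].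
have span e x : e \in E2 -> x \in C -> ~~ spans e x.
  by move=> eE xC; apply: (uncoveredP _ _ (CU x xC)).
apply/planarP; split.
  by apply/forall_inP => e /setUP[];
    [move/(forall_inP s1)|move/(forall_inP s2)].
move=> e f /setUP[] eE /setUP[] fE; [exact: n1| | |exact: n2].
- apply/negP => /crossingP[a [b [c [d [[ae bf ce df] [ab bc cd]]]]]].
  apply: (negP (span f c fE (subsetP (sub1 e eE) _ ce))); apply/spansP.
  by exists b, d; split=> //; apply: ltnW.
- apply/negP => /crossingP[a [b [c [d [[ae bf ce df] [ab bc cd]]]]]].
  apply: (negP (span e b eE (subsetP (sub1 f fE) _ bf))); apply/spansP.
  by exists a, c; split=> //; apply: ltnW.
Qed.

Lemma root_component_union : root_component (E1 :|: E2) = C.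
Proof.
have /connected_onP[_ sub1 conn1] := E1C.
apply/setP => x; rewrite inE; apply/idP/idP => [|xC].
  apply: connect_invariant => // u v uC.
  rewrite /adjacent /= inE => /orP[uv|uv].
    by apply: (subsetP (sub1 _ uv)); rewrite set22.
  by have := edge_disjoint E2C uv (set21 u v); rewrite uC.
apply: connect_sub (conn1 root x rC xC) => a b ab; apply: connect1.
by rewrite /adjacent /= inE [_ \in E1]ab.
Qed.

(** If some vertex of [C] is at most [u], a path in [E1] from a non-root vertex of [C] at most [u]
    to the root has to pass over [u], and one of its edges spans [u]. *)
Lemma uncovered_union : uncovered (E1 :|: E2) = remaining C (uncovered E2).
Proof.
have /connected_onP[pE1 sub1 conn1] := E1C.
have -> : uncovered (E1 :|: E2) = uncovered E1 :&: uncovered E2.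
  apply/setP => u; rewrite in_setI.
  apply/uncoveredP/andP => [unc|[/uncoveredP u1 /uncoveredP u2] e /setUP[]].
  - by split; apply/uncoveredP => e eE; apply: unc; rewrite inE eE ?orbT.
  - exact: u1.
  - exact: u2.
rewrite /remaining; case: ifPn => [/eqP Cr|Cr].
  suff -> : uncovered E1 = setT by rewrite setTI.
  apply/setP => u; rewrite in_setT; apply/uncoveredP => e eE.
  have /planarP[s1 _] := pE1; have [a [b [ab ee]]] := simple_edge s1 eE.
  have := sub1 e eE; rewrite Cr ee subUset !sub1set !inE.
  by move=> /andP[/eqP ar /eqP br]; rewrite ar br ltnn in ab.
apply/setP => u; rewrite in_setI [RHS]in_set andbC; congr andb.
apply/uncoveredP/forall_inP => [unc c cC|lt e eE]; last first.
  apply/spansP => -[a [b [ae be au ub]]].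
  by have := lt a (subsetP (sub1 e eE) a ae); rewrite ltnNge au.
rewrite ltnNge; apply/negP => cu.
(* The path must start away from the root; when [u] is the root, [c] may be the root as well and
   another vertex of [C] is taken. *)
have [c' [c'C c'u c'r]] : exists c', [/\ c' \in C, (c' <= u)%N & (c' < i)%N].
  case: (ltnP u i) => [ui|iu].
    by exists c; split=> //; apply: leq_ltn_trans ui.
  have /subsetPn[c' c'C c'r] : ~~ (C \subset [set root]).
    by apply: contraNN Cr => sub; rewrite eqEsubset sub sub1set.
  exists c'; split=> //; first by apply: leq_trans iu; rewrite -ltnS.
  by rewrite ltn_neqAle -ltnS ltn_ord andbT; apply: contraNneq c'r => eq;
     rewrite inE; apply/eqP/val_inj.
(* If no edge spans [u], this set is closed under adjacency. The bound [x < i] excludes the root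
   also when [u] is the root. *)
have : root \in [set x : 'I_i.+1 | (x <= u)%N && (x < i)%N].
  apply: connect_invariant (conn1 c' root c'C rC); last by rewrite inE c'u.
  move=> x y; rewrite !inE => /andP[xu xi] xy.
  apply: contraTT (unc _ xy) => out; rewrite negbK; apply/spansP.
  exists x, y; rewrite set21 set22; split=> //.
  by have := ltn_ord u; lia.
by rewrite inE /= ltnn andbF.
Qed.

End Union.

(** Union is a bijection from pairs of a connected graph on [C] and a compatible graph onto the
    graphs with root component [C]; the first factor depends on the size of [C] only. *)
Lemma card_root_component C p : root \in C ->
  #|[set E | [&& planar E, #|uncovered E| == p & root_component E == C]]| =
  (num_connected_planar #|C| *
   #|[set E in compatible C | #|remaining C (uncovered E)| == p]|)%N.
Proof.
move=> rC; rewrite -card_connected_on -cardsX.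
set X := setX _ _.
have XP x : x \in X -> [/\ connected_on C x.1, x.2 \in compatible C &
    #|remaining C (uncovered x.2)| == p].
  by case: x => E1 E2; rewrite !inE => /andP[-> /andP[-> ->]].
rewrite -(@card_in_imset _ _ (fun x => x.1 :|: x.2) X).
  apply: eq_card => E; rewrite inE; apply/and3P/imsetP.
    move=> [pE cE /eqP EC]; have := root_component_split pE.
    rewrite EC /=; set E1 := [set e in E | _] => -[E1C E2C].
    have EE : E1 :|: (E :\: E1) = E.
      have /setIidPr sub : E1 \subset E.
        by apply/subsetP => e; rewrite inE => /andP[].
      by rewrite -{1}sub setID.
    exists (E1, E :\: E1) => //=.
    rewrite in_setX [in X in X && _]inE E1C /= inE E2C.
    by rewrite -(uncovered_union rC E1C E2C) EE.
  move=> [[E1 E2] /XP /= [E1C E2C cE] ->]; split.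
  - exact: planar_union E1C E2C.
  - by rewrite (uncovered_union rC).
  - by rewrite (root_component_union rC).
move=> [E1 E2] [F1 F2] /XP /= [E1C E2C _] /XP /= [F1C F2C _] EF.
have eq1 : E1 = F1 by rewrite -(union_left E1C E2C) EF (union_left F1C F2C).
by rewrite -(union_right E1C E2C) EF eq1 (union_right F1C F2C).
Qed.

End RootComponent.

(** * Counting the possible components of the root *)

Lemma sum_powerset (T : finType) (W : {set T}) (F : nat -> nat) :
  (\sum_(D in powerset W) F #|D| = \sum_(j < #|W|.+1) 'C(#|W|, j) * F j)%N.
Proof.
rewrite (partition_big (fun D : {set T} => inord #|D| : 'I_#|W|.+1) xpredT) //=.
apply: eq_bigr => j _; rewrite -cards_draws -sum_nat_const.
apply: eq_big => [D|D /andP[]]; last first.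
  rewrite powersetE => /subset_leq_card DW /eqP <-.
  by rewrite inordK.
rewrite powersetE inE; apply: andb_id2l => /subset_leq_card DW.
by rewrite -val_eqE /= inordK.
Qed.

Section RootSubsets.
Variable i : nat.
Local Notation root := (@ord_max i).
Implicit Types (C U : {set 'I_i.+1}) (x y : 'I_i.+1).

Definition below U x : {set 'I_i.+1} := [set u in U | (u < x)%N].

Lemma below_card_lt U x y : x \in U -> (x < y)%N ->
  (#|below U x| < #|below U y|)%N.
Proof.
move=> xU xy; apply: proper_card; apply/properP; split.
  by apply/subsetP => u; rewrite !inE => /andP[-> /ltn_trans->].
by exists x; rewrite !inE ?xU // ltnn.
Qed.

Lemma below_card_inj U : {in U &, injective (fun x => #|below U x|)}.
Proof.
move=> x y xU yU eq; case: (ltngtP x y) => [xy|yx|/val_inj //].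
  by have := below_card_lt xU xy; rewrite eq ltnn.
by have := below_card_lt yU yx; rewrite eq ltnn.
Qed.

(** The witness is the element of rank [p] in the increasing enumeration of [U], counting from 0. *)
Lemma below_card_onto U p : (p < #|U|)%N ->
  exists2 x, x \in U & #|below U x| = p.
Proof.
move=> pU; pose f : 'I_#|U| -> 'I_i.+1 := Order.enum_val.
have lt_f a b : (f a < f b)%N = (a < b)%N.
  by rewrite !ltnNge leq_enum_val.
exists (f (Ordinal pU)); first exact: Order.enum_valP.
have -> : below U (f (Ordinal pU)) = f @: [set j : 'I_#|U| | (j < p)%N].
  apply/setP => u; rewrite inE; apply/andP/imsetP => [[]|[j]].
    rewrite -{1}(imset_enum_val U) => /imsetP[j _ ->]; rewrite lt_f => jp.
    by exists j; rewrite // inE.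
  by rewrite inE => jp ->; rewrite lt_f; split=> //; apply: Order.enum_valP.
rewrite card_imset; last exact: Order.enum_val_inj.
by rewrite -sum1dep_card (big_ord_narrow (ltnW pU)) sum1_card card_ord.
Qed.

Lemma remaining_min C U : root \in C -> C != [set root] ->
  exists y, [/\ y \in C, (y < i)%N, {in C, forall u : 'I_i.+1, (y <= u)%N} &
    remaining C U = below U y].
Proof.
move=> rC Cr; case: (arg_minnP (fun y : 'I_i.+1 => val y) rC) => y yC ymin.
have yi : (y < i)%N.
  rewrite ltn_neqAle -ltnS ltn_ord andbT; apply: contraNneq Cr => eq.
  rewrite eqEsubset sub1set rC andbT; apply/subsetP => c cC; rewrite inE.
  apply/eqP/val_inj => /=.
  by have := ymin c cC; have := ltn_ord c; rewrite /=; lia.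
exists y; split=> //; rewrite /remaining (negPf Cr).
apply/setP => u; rewrite !inE; congr andb; apply/forall_inP/idP => [|uy c cC].
  exact.
exact: leq_trans uy (ymin c cC).
Qed.

(** This is a matrix entry: row [p], column [#|U|.-1], the predecessor discounting the root, which
    belongs to [U]. The component reduced to the root gives the subdiagonal 1, all others the
    entries above the diagonal. *)
Lemma sum_remaining (c : nat -> nat) U (p : nat) : c 1%N = 1%N -> root \in U ->
  (\sum_(C : {set 'I_i.+1} |
        [&& root \in C, C \subset U & #|remaining C U| == p]) c #|C| =
   if p < #|U|.-1 then binomial_sum c (#|U|.-1 - p + 1)
   else if #|U|.-1 + 1 == p then 1 else 0)%N.
Proof.
move=> c1 rU; have U0 : (0 < #|U|)%N by apply/card_gt0P; exists root.
set S := RHS.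
rewrite (bigID (pred1 [set root])) /=.
have -> : (\sum_(C : {set 'I_i.+1} |
    [&& root \in C, C \subset U & #|remaining C U| == p] &&
    (C == [set root])) c #|C| = (#|U| == p))%N.
  rewrite big_andbC big_mkcondr big_pred1_eq in_set1 eqxx sub1set rU /=.
  by rewrite /remaining eqxx cards1 c1; case: eqP.
(* Both [y] and the root are missing from [below U y], so a larger component strictly lowers the
   degree. *)
have belowU y : y \in U -> (y < i)%N -> (#|below U y| < #|U|.-1)%N.
  move=> yU yi; apply: leq_trans (below_card_lt (y := root) yU yi) _.
  rewrite [#|U|](cardsD1 root) rU; apply: subset_leq_card; apply/subsetP => u.
  by rewrite !inE => /andP[-> ui]; rewrite -val_eqE /= ltn_eqF.
case: (ltnP p #|U|.-1) => [pU|Up]; last first.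
  rewrite big1 ?addn0 => [|C /andP[/and3P[rC CU /eqP Cp] Cr]].
    by rewrite /S ltnNge Up /= addn1 prednK //; case: eqP.
  have [y [yC yi _ eq]] := remaining_min U rC Cr.
  by have := belowU y (subsetP CU y yC) yi; rewrite -eq Cp ltnNge Up.
rewrite /S pU gtn_eqF ?add0n; last by lia.
have [|x xU xp] := @below_card_onto U p; first by lia.
have xi : (x < i)%N.
  rewrite ltn_neqAle -ltnS ltn_ord andbT; apply: contraTneq pU => eq.
  rewrite -leqNgt -xp [#|U|](cardsD1 root) rU; apply: subset_leq_card.
  apply/subsetP => u; rewrite !inE eq => /andP[nr ->] /=.
  by rewrite ltn_neqAle -ltnS ltn_ord andbT.
(* The least vertex of [C] must be [x], of rank [p]; apart from [x] and the root, [C] is an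
   arbitrary subset of [W]. *)
pose W := [set u in U | (x < u < i)%N].
have rW : root \notin W by rewrite inE /= ltnn !andbF.
have xW : x \notin W by rewrite inE ltnn andbF.
have xr : x != root by rewrite -val_eqE /= ltn_eqF.
have cardW : #|U| = (p + #|W|.+2)%N.
  have -> : U = below U x :|: (x |: (root |: W)).
    apply/setP => u; rewrite !inE; case uU: (u \in U) => /=.
      by rewrite -!val_eqE /=; have := ltn_ord u; lia.
    rewrite orbF; apply/esym/negbTE; apply: contraFN uU.
    by case/orP=> /eqP->.
  rewrite cardsU (_ : _ :&: _ = finset.set0) ?cards0 ?subn0 ?xp.
    by rewrite !cardsU1 !inE (negPf xr) ltnn /= ltnn !andbF.
  apply/setP => u; rewrite !inE -!val_eqE /=.
  by case: (u \in U) => //=; lia.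
pose h (D : {set 'I_i.+1}) := x |: (root |: D).
have hD (D : {set 'I_i.+1}) : D \subset W -> h D :\: [set x; root] = D.
  move=> DW; apply/setP => u; rewrite !inE negb_or.
  case: (eqVneq u x) => [->|ux] /=; first by rewrite (contraNF (subsetP DW x)).
  by case: (eqVneq u root) => [->|ur] //=; rewrite (contraNF (subsetP DW root)).
transitivity (\sum_(C in h @: powerset W) c #|C|)%N.
  apply: eq_bigl => C; apply/andP/imsetP.
    move=> [/and3P[rC CU /eqP Cp] Cr].
    have [y [yC yi ymin eq]] := remaining_min U rC Cr.
    have xy : y = x.
      by apply: (below_card_inj (subsetP CU y yC) xU); rewrite -eq Cp xp.
    subst y; exists (C :\: [set x; root]).
      rewrite powersetE; apply/subsetP => u; rewrite !inE -!val_eqE /=.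
      move=> /andP[+ uC]; rewrite (subsetP CU u uC) /=.
      by have := ymin u uC; have := ltn_ord u; lia.
    apply/setP => u; rewrite !inE.
    by case: (eqVneq u x) => [->|ux] //=; case: (eqVneq u root) => [->|ur].
  move=> [D]; rewrite powersetE => DW ->.
  have DU u : u \in D -> (u \in U) && (x < u)%N.
    by move=> /(subsetP DW); rewrite inE => /and3P[-> ->].
  have hr : h D != [set root].
    by apply: contraNneq xr => eq; rewrite -in_set1 -eq !inE eqxx.
  split=> //; apply/and3P; split; first by rewrite !inE eqxx orbT.
    apply/subsetP => u; rewrite !inE => /or3P[/eqP->|/eqP->|/DU/andP[]] //.
  rewrite -xp /remaining (negPf hr); apply/eqP/eq_card => u; rewrite !inE.
  congr andb; apply/forall_inP/idP => [|ux v].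
    by apply; rewrite !inE eqxx.
  rewrite !inE => /or3P[/eqP->|/eqP->|/DU/andP[_]] //.
    exact: ltn_trans xi.
  exact: ltn_trans.
rewrite big_imset /=; last first.
  move=> D D'; rewrite !powersetE => DW D'W eq.
  by rewrite -(hD D DW) -(hD D' D'W) eq.
transitivity (\sum_(D in powerset W) c (#|D| + 2))%N.
  apply: eq_bigr => D; rewrite powersetE => DW.
  rewrite !cardsU1 in_setU1 (negPf xr) /= (contraNN (subsetP DW x) xW).
  by rewrite (contraNN (subsetP DW root) rW) addn2.
rewrite (sum_powerset W (fun j => c (j + 2)%N)) /binomial_sum.
(* The shift by 2 in [binomial_sum] accounts for [x] and the root. *)
have -> : (#|U|.-1 - p + 1 = #|W|.+2)%N by lia.
rewrite -[2%N]add0n big_addn big_mkord !subSS subn0.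
by apply: eq_bigr => j _; rewrite !add0n subn0 addnK.
Qed.

End RootSubsets.

(** This gives weight 1 to a root that forms a component by itself; [binomial_sum] starts at size
    2. *)
Lemma num_connected_planar1 : num_connected_planar 1 = 1%N.
Proof.
apply: (@eq_card1 _ finset.set0) => E; rewrite !inE.
apply/andP/eqP => [[/planarP[/forall_inP sE _] _]|->].
  apply/setP => e; rewrite in_set0; apply/negbTE/negP => /sE /eqP e2.
  by have := max_card (mem e); rewrite e2 card_ord.
split; last first.
  by apply/forallP => a; apply/forallP => b; rewrite !ord1 connect0.
by apply/planarP; split=> [|e f]; [apply/forall_inP => e|]; rewrite in_set0.
Qed.

(** * The recurrence for the number of graphs of given degree *)

Section Recurrence.
Variable i : nat.
Local Notation root := (@ord_max i).

(** The extra uncovered vertex is the new root, whose label exceeds every endpoint of an edge. *)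
Lemma uncovered_relabel_widen (E : {set {set 'I_i}}) :
  #|uncovered (relabel (widen_ord (leqnSn i)) E)| = #|uncovered E|.+1.
Proof.
set f := widen_ord _; have f_inj : injective f.
  by move=> a b /(congr1 val) ab; apply: val_inj.
have -> : uncovered (relabel f E) = root |: f @: uncovered E.
  apply/setP => u; rewrite in_setU1.
  case: (ltnP u i) => [ui|iu].
    have -> : u = f (Ordinal ui) by apply: val_inj.
    rewrite uncovered_relabel // mem_imset //.
    by rewrite -val_eqE /= ltn_eqF.
  have -> : u = root by apply: val_inj => /=; have := ltn_ord u; lia.
  rewrite eqxx; apply/uncoveredP => _ /imsetP[e _ ->]; apply/spansP.
  move=> [_ [_ [_ /imsetP[b _ ->] _]]] /=; apply/negP; rewrite -ltnNge.
  exact: ltn_ord.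
rewrite cardsU1 card_imset // (_ : root \notin _) //.
apply/imsetP => -[a _ /(congr1 val) /= ai].
by have := ltn_ord a; rewrite -ai ltnn.
Qed.

Lemma avoids_root_relabel :
  [set E : {set {set 'I_i.+1}} | planar E && avoids_root E] =
  relabel (widen_ord (leqnSn i)) @: [set E : {set {set 'I_i}} | planar E].
Proof.
set f := widen_ord _; have le_f a b : (f a <= f b)%N = (a <= b)%N by [].
apply/setP => E; rewrite inE; apply/andP/imsetP => [[pE /forall_inP aE]|].
  have [A AE|E0 EE0] := @relabel_onto _ _ f E.
    apply/subsetP => u uA; have ui : (u < i)%N.
      rewrite ltn_neqAle -ltnS ltn_ord andbT; apply: contraNneq (aE A AE) => eq.
      by rewrite (_ : root = u) //; apply: val_inj.
    by apply/imsetP; exists (Ordinal ui) => //; apply: val_inj.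
  by exists E0 => //; rewrite inE -(planar_relabel le_f) -EE0.
move=> [E0]; rewrite inE => pE ->; rewrite planar_relabel //; split=> //.
apply/forall_inP => _ /imsetP[e _ ->].
apply/imsetP => -[a _ /(congr1 val) /= ai].
by have := ltn_ord a; rewrite -ai ltnn.
Qed.

Lemma card_uncovered_recurrence p :
  #|[set E : {set {set 'I_i.+1}} | planar E && (#|uncovered E| == p)]| =
  (\sum_(E : {set {set 'I_i}} | planar E)
     if p < #|uncovered E|
     then binomial_sum num_connected_planar (#|uncovered E| - p + 1)
     else if #|uncovered E| + 1 == p then 1 else 0)%N.
Proof.
rewrite -sum1_card (partition_big (@root_component i) (fun C => root \in C)) /=;
  last by move=> E _; rewrite inE connect0.
transitivity (\sum_(C : {set 'I_i.+1} | root \in C)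
    \sum_(E in compatible C | #|remaining C (uncovered E)| == p)
       num_connected_planar #|C|)%N.
  apply: eq_bigr => C rC; rewrite [RHS]sum_nat_const [RHS]mulnC.
  transitivity (num_connected_planar #|C| *
      #|[set E in compatible C | #|remaining C (uncovered E)| == p]|)%N;
    last first.
    by congr muln; apply: eq_card => E; rewrite in_set.
  rewrite -(card_root_component p rC) -sum1_card; apply: eq_bigl => E.
  by rewrite !inE andbA.
(* From here the graph avoiding the root is fixed first, and the component [C] ranges over subsets
   of its uncovered vertices. *)
rewrite (exchange_big_dep (fun E => planar E && avoids_root E)) /=; last first.
  by move=> C E rC; rewrite inE => /andP[/and3P[-> -> _] _].
transitivity (\sum_(E in relabel (widen_ord (leqnSn i)) @:
      [set E : {set {set 'I_i}} | planar E])
    if p < #|uncovered E|.-1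
    then binomial_sum num_connected_planar (#|uncovered E|.-1 - p + 1)
    else if #|uncovered E|.-1 + 1 == p then 1 else 0)%N.
  rewrite -avoids_root_relabel; apply: eq_big => [E|E /andP[pE aE]].
    by rewrite inE.
  rewrite -sum_remaining; first last.
  - apply/uncoveredP => e eE; apply/spansP => -[a [b [_ be _ ib]]].
    move: (forall_inP aE e eE); rewrite (_ : root = b) ?be //.
    by apply: val_inj => /=; move: ib => /=; have := ltn_ord b; lia.
  - exact: num_connected_planar1.
  by apply: eq_bigl => C; rewrite inE pE aE /= andbA.
rewrite big_imset /=; last by move=> E F _ _; apply: relabel_inj.
apply: eq_big => [E|E _]; first by rewrite inE.
by rewrite uncovered_relabel_widen.
Qed.

End Recurrence.

(** * Return to the geometric counts and the matrix product *)

Lemma num_connectedE (R : realType) k (p : 'I_k -> 'rV[R]_2) :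
  counterclockwise p -> num_connected p = num_connected_planar k.
Proof.
move=> hp; apply: eq_card => E.
by rewrite [LHS]in_set [RHS]in_set plane_graphsE // in_set.
Qed.

Lemma isolation_vectorE (R : realType) n i (p : 'I_i.+1 -> 'rV[R]_2) j :
  counterclockwise p -> isolation_vector n p j 0 =
    #|[set E : {set {set 'I_i}} | planar E && (#|uncovered E| == j)]|.
Proof.
move=> hp; rewrite mxE; apply: eq_card => E; rewrite [LHS]in_set [RHS]in_set.
rewrite plane_graphsE; last exact: counterclockwise_vertices.
rewrite in_set; apply: andb_id2l => /planarP[sE _].
by rewrite isolation_degreeE.
Qed.

Theorem theorem14 (R : realType) (n : nat) (hn : (3 <= n)%N)
    (s : forall k, 'I_k -> 'rV[R]_2) (hs : forall k, ccw_convex (s k))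
    (p : forall k, 'I_k -> 'rV[R]_2) (hp : forall k, ccw_convex (p k)) :
  let c := fun k => num_connected (s k) in
  let v := fun i => isolation_vector n (p i.+1) in
  forall i : nat, (1 <= i)%N -> (i + 2 <= n)%N ->
    v i.+1 = production_matrix (binomial_sum c) n *m v i.
Proof.
move=> c v i _ i2n.
have cE j : binomial_sum c j = binomial_sum num_connected_planar j.
  by apply: eq_bigr => k _; rewrite /c num_connectedE //; case: (hs k).
apply/matrixP => j z; rewrite (ord1 z) [RHS]mxE isolation_vectorE;
  last by case: (hp i.+2).
(* Degrees on [i] points are at most [i < n], so each one is a column index and no graph is lost
   when they are grouped by degree. *)
have unc_lt (E : {set {set 'I_i}}) : (#|uncovered E| < n)%N.
  by apply: leq_ltn_trans (max_card _) _; rewrite card_ord; lia.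
rewrite card_uncovered_recurrence.
rewrite (partition_big (fun E => Ordinal (unc_lt E)) xpredT) //=.
apply: eq_bigr => q _; rewrite isolation_vectorE; last by case: (hp i.+1).
rewrite mxE -sum1_card -[RHS]/(_ * _)%N big_distrr /=.
apply: eq_big => [E|E /andP[_ /eqP <-]]; first by rewrite inE -val_eqE.
by rewrite cE muln1.
Qed.
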